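(* Let $\ell\ge2$, $\ell_1=\lfloor\ell/2\rfloor$. Let $A_1=\begin{pmatrix}a&0\\0&-a\end{pmatrix}\in\mathfrak g(\mathfrak o_{\ell_1})$ with $a\in\mathfrak o_{\ell_1}^\times$ and $A_2=\begin{pmatrix}0&\epsilon\pi\beta\\ \epsilon&0\end{pmatrix}\in\mathfrak g(\mathfrak o_{\ell_1})$ with $\beta\in\mathfrak o_{\ell_1}$, such that $\mathrm{tt}(A_1)=\mathbf{ss}$ and $\mathrm{tt}(A_2)=\mathbf{sns}$. Fix Serre lifts $\tilde A_1,\tilde A_2\in\mathfrak g(\mathfrak o_\ell)$. For $g\in\mathrm G(\mathfrak o_\ell)$ let $W_g$ be the set of double cosets $S_{A_1}hS_{A_2}$, $h\in\mathrm G(\mathfrak o_\ell)$, such that $\tilde A_1+g\tilde A_2g^{-1}$ and $\tilde A_1+h\tilde A_2h^{-1}$ are $\mathrm G(\mathfrak o_\ell)$-conjugate modulo $\pi^{\ell_1}$. Then for $g=[g_{ij}]\in\mathrm G(\mathfrak o_\ell)$, $|W_g|=1$ if $g_{12},g_{22}\in R_\ell^\times$, and $|W_g|=2$ otherwise.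
   Context: Let $\mathcal O$ be a complete discrete valuation ring with maximal ideal $\mathfrak p=\pi\mathcal O$ and finite residue field of odd characteristic and cardinality $q$. Let $\mathfrak O=\mathcal O[\vartheta]$ be the unramified quadratic extension, with $\vartheta^2\in\mathcal O^\times$ a non-square, and Galois involution $x\mapsto x^\circ$, $\vartheta^\circ=-\vartheta$. Let $\mathfrak o_k=\mathcal O/\mathfrak p^k$ and $\mathfrak O_k=\mathfrak O/\pi^k\mathfrak O$. $\mathrm G$ denotes either $\mathrm{GL}_2$ (so $\mathrm G(\mathfrak o_k)=\mathrm{GL}_2(\mathfrak o_k)$, $R_k=\mathfrak o_k$, $\epsilon=1$, $\mathfrak g(\mathfrak o_k)=M_2(\mathfrak o_k)$) or $\mathrm{GU}_2$ (so $\mathrm G(\mathfrak o_k)=\{A\in \mathrm{GL}_2(\mathfrak O_k): A^\star A=I\}$ where $(a_{ij})^\star=W(a_{ji}^\circ)W^{-1}$, $W=\begin{pmatrix}0&1\\1&0\end{pmatrix}$, $R_k=\mathfrak O_k$, $\epsilon=\vartheta$, $\mathfrak g(\mathfrak o_k)=\{A\in M_2(\mathfrak O_k):A+A^\star=0\}$). Let $\ell_2=\lceil\ell/2\rceil$, $K^{i}=\{I+\pi^iB\}\cap\mathrm G(\mathfrak o_\ell)$, and fix an additive character $\psi$ of $R_\ell$ nontrivial on $\pi^{\ell-1}\mathfrak o_\ell$. For $A\in\mathfrak g(\mathfrak o_{\ell_1})$, $\psi_A(I+\pi^{\ell_2}B)=\psi(\pi^{\ell_2}\mathrm{tr}(\tilde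 AB))$ ($\tilde A$ any lift) is a character of $K^{\ell_2}$ and $S_A$ is its stabilizer in $\mathrm G(\mathfrak o_\ell)$ under conjugation. A Serre lift of $A=[a_{st}]\in\mathfrak g(\mathfrak o_{\ell_1})$ is a lift $\tilde A=[\tilde a_{st}]\in\mathfrak g(\mathfrak o_\ell)$ with $\tilde a_{st}=\epsilon$ whenever $a_{st}=\epsilon$ and $\tilde a_{st}=0$ whenever $a_{st}=0$. Matrix types: $\mathrm{tt}(A)=\mathbf{sns}$ if $A$ is conjugate to $\begin{pmatrix}x&\epsilon\pi\beta\\ \epsilon&x\end{pmatrix}$; $\mathrm{tt}(A)=\mathbf{ss}$ if $A$ is conjugate to $\begin{pmatrix}x&\epsilon\delta\\ \epsilon&x\end{pmatrix}$ with $\delta$ a unit that is a square (for $\mathrm{GL}_2$) resp. a non-square (for $\mathrm{GU}_2$). *)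

(* Defs.v *)
From HB Require Import structures.
From mathcomp Require Import all_boot all_order all_algebra.
From mathcomp Require Import algC.
From mathcomp Require Import ring.
Set Implicit Arguments. Unset Strict Implicit. Unset Printing Implicit Defensive.
Import GRing.Theory.
Local Open Scope ring_scope.

(* Congruences.  Elements of R/mR are represented by lifts in R.       *)

Definition congr_mod (R : pzRingType) (m x y : R) : Prop :=
  exists z : R, x - y = m * z.

Definition mcong (R : pzRingType) (m : R) (A B : 'M[R]_2) : Prop :=
  forall i j : 'I_2, congr_mod m (A i j) (B i j).

Definition unit_mod (R : pzRingType) (m x : R) : Prop :=
  exists y : R, congr_mod m (x * y) 1.

Definition mx22 (R : pzRingType) (a b c e : R) : 'M[R]_2 :=
  \matrix_(i < 2, j < 2)
     if i == ord0 then (if j == ord0 then a else b)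
     else (if j == ord0 then c else e).

(* indices 1 and 2 of the paper (0-based ordinals) *)
Definition i1 : 'I_2 := ord0.
Definition i2 : 'I_2 := ord_max.

Definition complete_dvr (O : idomainType) (pi : O) : Prop :=
  pi != 0 /\ pi \notin GRing.unit /\
  (forall x : O, x != 0 -> exists (n : nat) (u : O),
       u \is a GRing.unit /\ x = u * pi ^+ n) /\
  (forall s : nat -> O, (forall n, congr_mod (pi ^+ n) (s n.+1) (s n)) ->
       exists x : O, forall n, congr_mod (pi ^+ n) x (s n)) /\
  (exists r : seq O, forall x : O, exists2 y, y \in r & congr_mod pi x y) /\
  ~ congr_mod pi 2 0.

(* The unramified quadratic extension  O[theta], theta^2 = d.           *)
(* Elements are pairs (x, y) standing for x + y theta.                 *)
Definition qext (O : comNzRingType) (d : O) : Type := (O * O)%type.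
Section QuadExt.
Variables (O : comNzRingType) (d : O).
HB.instance Definition _ := GRing.Zmodule.copy (qext d) (O * O)%type.
Definition qmul (x y : qext d) : qext d :=
  (x.1 * y.1 + d * x.2 * y.2, x.1 * y.2 + x.2 * y.1).
Definition qone : qext d := (1, 0).
Lemma qmulA : associative qmul.
Proof. by case=> a b [c e] [f g]; rewrite /qmul /=; congr pair; ring. Qed.
Lemma qmulC : commutative qmul.
Proof. by case=> a b [c e]; rewrite /qmul /=; congr pair; ring. Qed.
Lemma qmul1 : left_id qone qmul.
Proof. by case=> a b; rewrite /qmul /=; congr pair; ring. Qed.
Lemma qmulD : left_distributive qmul +%R.
Proof.
by case=> a b [c e] [f g]; rewrite /qmul /=; congr pair; rewrite /=; ring.
Qed.
Lemma qone_neq0 : qone != 0. Proof. by rewrite xpair_eqE oner_eq0. Qed.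
HB.instance Definition _ :=
  GRing.Zmodule_isComNzRing.Build (qext d) qmulA qmulC qmul1 qmulD qone_neq0.

Definition qemb (x : O) : qext d := (x, 0).
Definition qtheta : qext d := (0, 1).
Definition qconj (x : qext d) : qext d := (x.1, - x.2).
End QuadExt.

(* The groups G(o_k) and Lie algebras g(o_k), as predicates on lifts.  *)
(* rho is the uniformizer viewed in R (= R_l before reduction).         *)

Definition inGL (R : pzRingType) (rho : R) (k : nat) (g : 'M[R]_2) : Prop :=
  exists gi : 'M[R]_2,
    mcong (rho ^+ k) (g *m gi) 1%:M /\ mcong (rho ^+ k) (gi *m g) 1%:M.

(* M_2(R / rho^k R): everything *)
Definition ingl (R : pzRingType) (k : nat) (A : 'M[R]_2) : Prop := True.

Definition Wmx (R : pzRingType) : 'M[R]_2 := mx22 0 1 1 0.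

(* (a_ij)^* = W (a_ji^o) W^{-1},  W^{-1} = W *)
Definition qstar (O : comNzRingType) (d : O) (A : 'M[qext d]_2) : 'M[qext d]_2 :=
  Wmx _ *m (map_mx (@qconj O d) A)^T *m Wmx _.

Definition inGU (O : comNzRingType) (d : O) (rho : qext d) (k : nat)
    (g : 'M[qext d]_2) : Prop :=
  inGL rho k g /\ mcong (rho ^+ k) (qstar g *m g) 1%:M.

Definition ingu (O : comNzRingType) (d : O) (rho : qext d) (k : nat)
    (A : 'M[qext d]_2) : Prop :=
  mcong (rho ^+ k) (A + qstar A) 0.

Definition sq_mod (O : comNzRingType) (pi : O) (k : nat) (delta : O) : Prop :=
  exists y : O, congr_mod (pi ^+ k) delta (y * y).

Definition has_card (T : Type) (P : T -> Prop) (n : nat) : Prop :=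
  exists f : 'I_n -> T, injective f /\ (forall x, P x <-> exists i, x = f i).

(* Generic statement, for a group datum                               *)
(*   R (= O or O[theta]), iota : O -> R, pi, eps, G, g, square cond.  *)
Section Claim.
Variables (O R : comNzRingType) (iota : O -> R) (pi : O) (eps : R)
  (inG ing : nat -> 'M[R]_2 -> Prop) (sqc : nat -> O -> Prop) (l : nat).

Definition l1 : nat := l./2.
Definition l2 : nat := l - l./2.

Definition mc (k : nat) : 'M[R]_2 -> 'M[R]_2 -> Prop :=
  mcong (iota pi ^+ k).

Definition ginv (k : nat) (x xi : 'M[R]_2) : Prop :=
  inG k x /\ mc k (x *m xi) 1%:M.

Definition Gconj (k : nat) (M N : 'M[R]_2) : Prop :=
  exists x xi, ginv l x xi /\ mc k (x *m M *m xi) N.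

Definition tt_ss (A : 'M[R]_2) : Prop :=
  exists (x : R) (delta : O) (c ci : 'M[R]_2),
    ginv l1 c ci /\ unit_mod (pi ^+ l1) delta /\ sqc l1 delta /\
    mc l1 (c *m A *m ci) (mx22 x (eps * iota delta) eps x).

Definition tt_sns (A : 'M[R]_2) : Prop :=
  exists (x : R) (beta : O) (c ci : 'M[R]_2),
    ginv l1 c ci /\
    mc l1 (c *m A *m ci) (mx22 x (eps * iota (pi * beta)) eps x).

Definition serre_lift (A At : 'M[R]_2) : Prop :=
  ing l At /\ mc l1 At A /\
  forall i j : 'I_2,
    (congr_mod (iota pi ^+ l1) (A i j) eps -> congr_mod (iota pi ^+ l) (At i j) eps) /\
    (congr_mod (iota pi ^+ l1) (A i j) 0 -> congr_mod (iota pi ^+ l) (At i j) 0).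

Definition add_char (psi : R -> algC) : Prop :=
  (forall x y, psi (x + y) = psi x * psi y) /\
  (forall z, psi (iota pi ^+ l * z) = 1) /\
  (exists z : O, psi (iota (pi ^+ l.-1 * z)) != 1).

Definition inK (k : 'M[R]_2) : Prop := inG l k /\ mc l2 k 1%:M.

(* psi_A (I + pi^{l2} B) = psi (pi^{l2} tr (At B)) = psi (tr (At (k - I))) *)
Definition psiA (psi : R -> algC) (At k : 'M[R]_2) : algC :=
  psi (\tr (At *m (k - 1%:M))).

Definition inS (psi : R -> algC) (At s : 'M[R]_2) : Prop :=
  exists si, ginv l s si /\
    forall k, inK k -> psiA psi At (s *m k *m si) = psiA psi At k.

(* the double coset S_{A1} h S_{A2}, as a (saturated) set of lifts *)
Definition dcoset (psi : R -> algC) (A1t A2t h : 'M[R]_2) : 'M[R]_2 -> Prop :=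
  fun m => exists s1 s2, inS psi A1t s1 /\ inS psi A2t s2 /\
                        mc l m (s1 *m h *m s2).

Definition Wset (psi : R -> algC) (A1t A2t g : 'M[R]_2) :
    ('M[R]_2 -> Prop) -> Prop :=
  fun D => exists h, inG l h /\
    (exists gi hi, ginv l g gi /\ ginv l h hi /\
       Gconj l1 (A1t + g *m A2t *m gi) (A1t + h *m A2t *m hi)) /\
    D = dcoset psi A1t A2t h.

Definition claim : Prop :=
  forall (psi : R -> algC), add_char psi ->
  forall (a beta : O) (A1t A2t : 'M[R]_2),
  let A1 := mx22 (iota a) 0 0 (- iota a) in
  let A2 := mx22 0 (eps * iota (pi * beta)) eps 0 in
  unit_mod (pi ^+ l1) a -> ing l1 A1 -> ing l1 A2 ->
  tt_ss A1 -> tt_sns A2 ->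
  serre_lift A1 A1t -> serre_lift A2 A2t ->
  forall g : 'M[R]_2, inG l g ->
    ((unit_mod (iota pi ^+ l) (g i1 i2) /\ unit_mod (iota pi ^+ l) (g i2 i2)) ->
        has_card (Wset psi A1t A2t g) 1) /\
    (~ (unit_mod (iota pi ^+ l) (g i1 i2) /\ unit_mod (iota pi ^+ l) (g i2 i2)) ->
        has_card (Wset psi A1t A2t g) 2).
End Claim.

(* Main.v *)
Require Import Defs.
From HB Require Import structures.
From mathcomp Require Import all_boot all_order all_algebra.
From mathcomp Require Import algC.
From mathcomp Require Import ring zify.
From Stdlib Require Import Setoid Morphisms Classical.
From Stdlib Require Import FunctionalExtensionality PropExtensionality.
Set Implicit Arguments. Unset Strict Implicit. Unset Printing Implicit Defensive.
Import GRing.Theory.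
Local Open Scope ring_scope.

(** The pairing [(A, B) |-> psi (pi^l2 tr (A B))] is perfect, so [S_A] is the
    centralizer of [A] modulo [pi^l1].  The double coset of [h] is therefore
    the orbit of [X = h A_2 h^-1] under the centralizer of [A_1], which modulo
    [pi^l1] is the diagonal torus.  Write
    [X = [[x, eps y], [eps z, -x]]] with [x, y, z] in [O] and [eps^2 = e]; then
    [x^2 + e y z = e pi beta], and [A_1 + X] has determinant
    [-(a^2 + 2 a x + e pi beta)], so its conjugacy class determines [x].
    The torus scales [(y, z)] to [(y / t, t z)] for every unit [t] (for GU_2
    because units are norms).  If [x] is a unit so are [y] and [z], and there is
    one orbit; otherwise exactly one of [y], [z] is a unit, which gives two
    orbits, and both occur because [X] and its mirror image [(x, z, y)] are
    cyclic with the same characteristic polynomial, before and after adding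
    [A_1].  Modulo [pi], [X] is [eps] times the second column of [h] times the
    first row of [h^-1], whence [x] is a unit iff [h_12] and [h_22] are. *)

(** * Calculus of congruences for scalars and 2x2 matrices *)

Section Congruences.
Variables (R : comNzRingType) (m : R).
Implicit Types (x y z : R) (A B C : 'M[R]_2).

#[global] Instance congr_mod_equiv : Equivalence (congr_mod m).
Proof.
split=> [x|x y [z e]|x y z [u e] [v f]].
- by exists 0; rewrite subrr mulr0.
- by exists (- z); rewrite mulrN -e opprB.
- by exists (u + v); rewrite mulrDr -e -f addrA subrK.
Qed.

#[global] Instance congr_modD :
  Proper (congr_mod m ==> congr_mod m ==> congr_mod m) (@GRing.add R).
Proof.
move=> x x' [u e] y y' [v f]; exists (u + v); rewrite mulrDr -e -f; ring.
Qed.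

#[global] Instance congr_modN :
  Proper (congr_mod m ==> congr_mod m) (@GRing.opp R).
Proof. by move=> x x' [u e]; exists (- u); rewrite mulrN -e opprB opprK addrC. Qed.

#[global] Instance congr_modM :
  Proper (congr_mod m ==> congr_mod m ==> congr_mod m) (@GRing.mul R).
Proof.
move=> x x' [u e] y y' [v f]; exists (u * y + x' * v).
rewrite mulrDr mulrA -e mulrCA -f; ring.
Qed.

Lemma eq_congr x y : x = y -> congr_mod m x y.
Proof. by move=> ->; reflexivity. Qed.

Lemma congr_mod0P x : congr_mod m x 0 <-> exists z, x = m * z.
Proof. by rewrite /congr_mod subr0. Qed.

Lemma congr_mod_sub x y : congr_mod m x y <-> congr_mod m (x - y) 0.
Proof. by rewrite congr_mod0P. Qed.

Lemma congr_subr0 x y : congr_mod m (x - y) 0 -> congr_mod m x y.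
Proof. by rewrite -congr_mod_sub. Qed.

Lemma congr_mod_mulr z : congr_mod m (m * z) 0.
Proof. by apply/congr_mod0P; exists z. Qed.

Lemma congr_mod_weaken n x y : congr_mod (m * n) x y -> congr_mod m x y.
Proof. by case=> z e; exists (n * z); rewrite mulrA. Qed.

Lemma mx22_eta A : A = mx22 (A i1 i1) (A i1 i2) (A i2 i1) (A i2 i2).
Proof.
apply/matrixP=> i j; rewrite mxE; case: (eqVneq i ord0) => [->|].
  case: (eqVneq j ord0) => [-> //|]; case: j => -[|[|]] //= h _.
  by congr (A _ _); apply: val_inj.
case: i => -[|[|]] //= h _; case: (eqVneq j ord0) => [->|].
  by congr (A _ _); apply: val_inj.
case: j => -[|[|]] //= h' _.
by congr (A _ _); apply: val_inj.
Qed.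

Lemma mx22E (a b c e : R) :
  ((mx22 a b c e i1 i1 = a) * (mx22 a b c e i1 i2 = b))
  * ((mx22 a b c e i2 i1 = c) * (mx22 a b c e i2 i2 = e)).
Proof. by rewrite !mxE. Qed.

Lemma ord2_ind (P : 'I_2 -> Prop) : P i1 -> P i2 -> forall i, P i.
Proof.
move=> h1 h2 [[|[|]] //= h].
  by rewrite (_ : Ordinal h = i1) //; apply: val_inj.
by rewrite (_ : Ordinal h = i2) //; apply: val_inj.
Qed.

(** The entrywise quotients assemble into one matrix, so that products and traces of congruent
    matrices can be handled without looking at entries. *)
Lemma mcongP A B : mcong m A B <-> exists Z, A - B = m *: Z.
Proof.
split=> [h|[Z e] i j]; last first.
  by exists (Z i j); move/matrixP: e => /(_ i j); rewrite !mxE.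
have [[z1 e1] [z2 e2] [z3 e3] [z4 e4]] := And4 (h i1 i1) (h i1 i2) (h i2 i1) (h i2 i2).
exists (mx22 z1 z2 z3 z4); apply/matrixP.
by elim/ord2_ind; elim/ord2_ind; rewrite !mxE.
Qed.

#[global] Instance mcong_equiv : Equivalence (mcong m).
Proof.
split=> [A|A B h|A B C h k] i j; first by reflexivity.
  by symmetry; apply: h.
by transitivity (B i j); [apply: h | apply: k].
Qed.

#[global] Instance mcongD :
  Proper (mcong m ==> mcong m ==> mcong m) (@GRing.add 'M[R]_2).
Proof. by move=> A A' h B B' k i j; rewrite !mxE (h i j) (k i j); reflexivity. Qed.

#[global] Instance mcongN :
  Proper (mcong m ==> mcong m) (@GRing.opp 'M[R]_2).
Proof. by move=> A A' h i j; rewrite !mxE (h i j); reflexivity. Qed.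

#[global] Instance mcongM :
  Proper (mcong m ==> mcong m ==> mcong m) (@mulmx R 2 2 2).
Proof.
move=> A A' /mcongP[Z e] B B' /mcongP[Y f]; apply/mcongP.
exists (Z *m B + A' *m Y).
rewrite scalerDr scalemxAl scalemxAr -e -f mulmxBl mulmxBr.
by rewrite addrA subrK.
Qed.

#[global] Instance mcong_tr : Proper (mcong m ==> congr_mod m) (@mxtrace R 2).
Proof.
move=> A A' /mcongP[Z e]; exists (\tr Z).
by rewrite -linearB /= e linearZ.
Qed.

Lemma mul_mx22 (a b c e a' b' c' e' : R) :
  mx22 a b c e *m mx22 a' b' c' e' =
  mx22 (a * a' + b * c') (a * b' + b * e') (c * a' + e * c') (c * b' + e * e').
Proof.
by apply/matrixP; elim/ord2_ind; elim/ord2_ind; rewrite !mxE !big_ord_recl big_ord0 addr0 !mxE.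
Qed.

Lemma add_mx22 (a b c e a' b' c' e' : R) :
  mx22 a b c e + mx22 a' b' c' e' = mx22 (a + a') (b + b') (c + c') (e + e').
Proof. by apply/matrixP; elim/ord2_ind; elim/ord2_ind; rewrite !mxE. Qed.

Lemma scale_mx22 (k a b c e : R) :
  k *: mx22 a b c e = mx22 (k * a) (k * b) (k * c) (k * e).
Proof. by apply/matrixP; elim/ord2_ind; elim/ord2_ind; rewrite !mxE. Qed.

Lemma one_mx22 : 1%:M = mx22 1 0 0 1 :> 'M[R]_2.
Proof. by apply/matrixP; elim/ord2_ind; elim/ord2_ind; rewrite !mxE. Qed.

Lemma tr_mx22 (a b c e : R) : \tr (mx22 a b c e) = a + e.
Proof. by rewrite /mxtrace !big_ord_recl big_ord0 addr0 !mxE. Qed.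

Lemma det_mx22 (a b c e : R) : \det (mx22 a b c e) = a * e - b * c.
Proof.
rewrite (expand_det_row _ ord0) !big_ord_recl big_ord0 /cofactor !det_mx11 !mxE /=.
by rewrite expr0 expr1 addr0; ring.
Qed.

Lemma mcong_mx22 (a b c e a' b' c' e' : R) :
  congr_mod m a a' -> congr_mod m b b' -> congr_mod m c c' -> congr_mod m e e' ->
  mcong m (mx22 a b c e) (mx22 a' b' c' e').
Proof. by move=> ha hb hc he; elim/ord2_ind; elim/ord2_ind; rewrite !mxE. Qed.

#[global] Instance mcong_det : Proper (mcong m ==> congr_mod m) (fun A => \det A).
Proof.
move=> A A' h; rewrite (mx22_eta A) (mx22_eta A') !det_mx22.
by rewrite (h i1 i1) (h i1 i2) (h i2 i1) (h i2 i2); reflexivity.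
Qed.

#[global] Instance mcongZ :
  Proper (congr_mod m ==> mcong m ==> mcong m) (@GRing.scale R 'M[R]_2).
Proof.
by move=> x y e A A' h i j; rewrite !mxE (h i j) e; reflexivity.
Qed.

(* [A B = 1] forces [det A *: B = adj A], with [det A] invertible. *)
Lemma mcong_mul1C A B : mcong m (A *m B) 1%:M -> mcong m (B *m A) 1%:M.
Proof.
move=> h.
have hd : congr_mod m (\det B * \det A) 1.
  by rewrite mulrC -det_mulmx (mcong_det h) det1; reflexivity.
have hB : mcong m (\det A *: B) (\adj A).
  by rewrite -mul_scalar_mx -mul_adj_mx -mulmxA h mulmx1; reflexivity.
have : mcong m (\det B *: (\det A *: B *m A)) (\det B *: (\adj A *m A)).
  by rewrite hB; reflexivity.
rewrite mul_adj_mx -scalemxAl scalerA hd scale1r => ->.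
by rewrite -mul_scalar_mx -scalar_mxM -[1%:M]scalemx1 -[(_ * _)%:M]scalemx1 hd; reflexivity.
Qed.

Lemma mcong_inv_uniq A B C :
  mcong m (A *m B) 1%:M -> mcong m (A *m C) 1%:M -> mcong m B C.
Proof.
move=> hB hC; have hB' := mcong_mul1C hB.
by rewrite -[C]mul1mx -hB' -mulmxA hC mulmx1; reflexivity.
Qed.

End Congruences.

Lemma congr_mod_leq (R : comNzRingType) (p x y : R) (j k : nat) :
  (j <= k)%N -> congr_mod (p ^+ k) x y -> congr_mod (p ^+ j) x y.
Proof. by move=> le; rewrite -(subnKC le) exprD; apply: congr_mod_weaken. Qed.

Lemma mcong_leq (R : comNzRingType) (p : R) (A B : 'M[R]_2) (j k : nat) :
  (j <= k)%N -> mcong (p ^+ k) A B -> mcong (p ^+ j) A B.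
Proof. by move=> le h i i'; apply: congr_mod_leq le (h i i'). Qed.

(** Every fibre has at most two elements and the fibre of [x0] only one, so |S| is at most 2 |f(S)|
    - 1. The model case is squaring on a finite field of odd characteristic, with [x0] the zero
    element. *)
Lemma card_lt_double_image (S T : finType) (f : S -> T) (x0 : S) :
  (forall x, f x = f x0 -> x = x0) ->
  (forall x y z, f x = f y -> f x = f z -> [|| x == y, x == z | y == z]) ->
  (#|S| < 2 * #|f @: S|)%N.
Proof.
move=> h0 h2.
have fib y : (#|[set x | f x == y]| <= 2)%N.
  rewrite leqNgt; apply/negP => /card_gt2P[x [x' [x'' [[]]]]].
  rewrite !inE => /eqP e /eqP e' /eqP e'' [/negPf n1 /negPf n2 /negPf n3].
  have := h2 x x' x'' (etrans e (esym e')) (etrans e (esym e'')).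
  by rewrite n1 n2 eq_sym n3.
have fib0 : #|[set x | f x == f x0]| = 1%N.
  apply/eqP/cards1P; exists x0; apply/setP=> x; rewrite !inE.
  by apply/eqP/eqP => [/h0 | ->].
have -> : #|S| = (\sum_(y in f @: S) #|[set x | f x == y]|)%N.
  rewrite -sum1_card (partition_big_imset f) /=; apply: eq_bigr => y _.
  by rewrite -sum1_card; apply: eq_bigl => x; rewrite !inE.
have im0 : f x0 \in f @: S by apply: imset_f.
rewrite (bigD1 _ im0) /= fib0 (cardsD1 (f x0)) im0 mulnDr /=.
rewrite -addSn leq_add //; rewrite mulnC -sum_nat_const.
rewrite (eq_bigl (fun y => y \in f @: S :\ f x0)); first exact: leq_sum.
by move=> y; rewrite !inE andbC.
Qed.

(** * Units, square roots and norms over the valuation ring *)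

Section CompleteDvr.
Variables (O : idomainType) (pi : O).
Hypothesis dvr : complete_dvr pi.
Implicit Types (x y z u d : O).

Lemma nonunit_congr0 x : x \notin GRing.unit <-> congr_mod pi x 0.
Proof.
have [_ [hpi [hdec _]]] := dvr; split=> [hx|/congr_mod0P[z ->]]; last first.
  by rewrite unitrM (negPf hpi).
have [-> | /hdec[[|n] [u [hu e]]]] := eqVneq x 0; first by reflexivity.
  by move: hx; rewrite e mulr1 hu.
by apply/congr_mod0P; exists (u * pi ^+ n); rewrite e exprS mulrCA.
Qed.

Lemma unit_congr x : x \is a GRing.unit <-> ~ congr_mod pi x 0.
Proof.
rewrite -nonunit_congr0; split; first by move=> h /negP.
by move/negP; rewrite negbK.
Qed.

Lemma unit2 : (2 : O) \is a GRing.unit.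
Proof. by apply/unit_congr; case: dvr => _ [_ [_ [_ []]]]. Qed.

Lemma congr_unit x y : congr_mod pi x y -> y \is a GRing.unit -> x \is a GRing.unit.
Proof. by move=> e /unit_congr h; apply/unit_congr; rewrite e. Qed.

Lemma congr_mod_exp x y k : (0 < k)%N -> congr_mod (pi ^+ k) x y -> congr_mod pi x y.
Proof. by move=> k0; rewrite -[X in _ -> congr_mod X _ _]expr1; apply: congr_mod_leq. Qed.

Lemma unit_mod_unit x k : (0 < k)%N -> unit_mod (pi ^+ k) x -> x \is a GRing.unit.
Proof.
move=> k0 [y /(congr_mod_exp k0) e].
by have := congr_unit e (unitr1 _); rewrite unitrM => /andP[].
Qed.

Lemma congr_mod_cancel m u x y :
  u \is a GRing.unit -> congr_mod m (u * x) (u * y) -> congr_mod m x y.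
Proof. by move=> hu e; rewrite -[x](mulKr hu) e mulKr //; reflexivity. Qed.

(** Such a [c] is a unit times pi^n with n < k, hence divides pi^(k-1). This is what brings the
    nontriviality of the character on pi^(l-1) into play. *)
Lemma dvd_pi_exp_pred k c :
  ~ congr_mod (pi ^+ k) c 0 -> exists b, c * b = pi ^+ k.-1.
Proof.
have [_ [_ [hdec _]]] := dvr => hc.
have [c0 | /hdec[n [u [hu e]]]] := eqVneq c 0; first by case: hc; rewrite c0; reflexivity.
have ltnk : (n < k)%N.
  rewrite ltnNge; apply/negP => le; apply: hc; apply/congr_mod0P.
  by exists (u * pi ^+ (n - k)); rewrite e mulrCA -exprD subnKC.
exists (u^-1 * pi ^+ (k.-1 - n)).
rewrite e mulrACA mulrV // mul1r -exprD subnKC //.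
by rewrite -ltnS prednK // (leq_ltn_trans _ ltnk).
Qed.

(** Newton's iteration: if s^2 = v + pi^(k+1) w, then t = w / (2 s) exists because 2 and s are
    units, and (s - pi^(k+1) t)^2 = v + pi^(2k+2) t^2. *)
Lemma sqrt_congr1 v k : congr_mod pi v 1 ->
  exists s, congr_mod (pi ^+ k.+1) (s * s) v /\ congr_mod pi s 1.
Proof.
move=> hv; elim: k => [|k [s [[w e] hs]]].
  by exists 1; rewrite mulr1 expr1; split; [symmetry | reflexivity].
have us : s \is a GRing.unit := congr_unit hs (unitr1 _).
have u2s : 2 * s \is a GRing.unit by rewrite unitrM unit2.
pose t := w / (2 * s); have et : w = 2 * s * t by rewrite mulrC divrK.
exists (s - pi ^+ k.+1 * t); split; last first.
  rewrite exprS -mulrA; case: hs => z ez; exists (z - pi ^+ k * t).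
  by rewrite mulrBr -ez; ring.
exists (pi ^+ k * (t * t)); rewrite [v](_ : v = s * s - pi ^+ k.+1 * w); last first.
  by rewrite -e; ring.
by rewrite et !exprS; ring.
Qed.

(** Pigeonhole in the residue field: the values x^2 and the values u + d y^2 each fill more than
    half of the classes, so some value is common to both. *)
Lemma norm_residue d u : d \is a GRing.unit ->
  exists x y, congr_mod pi (x * x - d * y * y) u.
Proof.
move=> hd; have [_ [_ [_ [_ [[r hr] _]]]]] := dvr.
(* Congruence modulo [pi] is decided by the unit predicate, so the first congruent entry of [r]
   gives a canonical representative; these representatives form the finite type [F] modelling the
   residue field. *)
pose c x y := x - y \notin GRing.unit.
have cP x y : c x y <-> congr_mod pi x y.
  by rewrite congr_mod_sub -nonunit_congr0.
pose rep x := nth 0 r (find (c x) r).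
have hasr x : has (c x) r.
  by have [y yr e] := hr x; apply/hasP; exists y => //; apply/cP.
have crep x : congr_mod pi x (rep x) by apply/cP/(nth_find 0 (hasr x)).
have repE x y : congr_mod pi x y -> rep x = rep y.
  move=> e; rewrite /rep (@eq_find _ (c x) (c y)) // => z.
  by apply/idP/idP => /cP h; apply/cP; [rewrite -e | rewrite e].
have reps x : rep x \in [seq rep x | x <- r].
  apply/mapP; exists (rep x); last exact/repE/crep.
  by rewrite mem_nth // -has_find.
pose F : finType := seq_sub [seq rep x | x <- r].
pose cl x : F := SeqSub (reps x).
have clE x y : cl x = cl y <-> congr_mod pi x y.
  split=> [/(congr1 val) /= e | /repE e]; last exact: val_inj.
  by rewrite (crep x) (crep y) e; reflexivity.
have clK (x : F) : cl (val x) = x.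
  apply: val_inj => /=; have /mapP[y _ ->] := ssvalP x.
  by apply: repE; symmetry.
(* For a unit [e], two classes with the same value under [f b e] agree up to sign, and the class of
   0 is its own negative. *)
pose f b e (x : F) := cl (b + e * (val x * val x)).
have fE b e (x y : F) : e \is a GRing.unit -> f b e x = f b e y ->
    congr_mod pi ((val x - val y) * (val x + val y)) 0.
  move=> he /clE /congr_mod_sub h; apply: (congr_mod_cancel he).
  rewrite mulr0 (_ : e * _ = b + e * (val x * val x) - (b + e * (val y * val y))) //.
  by ring.
have fE2 b e (x y : F) : e \is a GRing.unit -> f b e x = f b e y ->
    x = y \/ congr_mod pi (val x) (- val y).
  move=> he /(fE _ _ _ _ he) /nonunit_congr0; rewrite unitrM negb_and.
  case/orP => /nonunit_congr0.
    by move/congr_subr0/clE; rewrite !clK; left.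
  by rewrite -[X in _ + X]opprK => /congr_subr0; right.
have fc b e : e \is a GRing.unit -> (#|F| < 2 * #|f b e @: F|)%N.
  move=> he; apply: (card_lt_double_image (x0 := cl 0)) => [x|x y z].
    have v0 : congr_mod pi (val (cl 0)) 0 by symmetry; apply: crep.
    case/(fE2 _ _ _ _ he) => // h; rewrite -(clK x) -(clK (cl 0)); apply/clE.
    by rewrite h v0 oppr0; reflexivity.
  case/(fE2 _ _ _ _ he) => [-> _|h]; first by rewrite eqxx.
  case/(fE2 _ _ _ _ he) => [->|k]; first by rewrite eqxx orbT.
  rewrite [y == z](_ : _ = true) ?orbT //; apply/eqP.
  rewrite -(clK y) -(clK z); apply/clE.
  by rewrite -[val y]opprK -h k opprK; reflexivity.
(* Disjoint images would have at most |F| elements together, while twice the size of each exceeds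
   |F|. *)
have : f 0 1 @: F :&: f u d @: F != set0.
  apply: contraTneq (fc 0 1 (unitr1 _)) => e0; rewrite -leqNgt.
  have le : (#|f 0%R 1%R @: F| + #|f u d @: F| <= #|F|)%N.
    have := cardsUI (f 0 1 @: F) (f u d @: F).
    by rewrite e0 cards0 addn0 => <-; apply: max_card.
  move: (fc u d hd) le; move: #|f 0 1 @: F| #|f u d @: F| #|F| => n1 n2 n; lia.
case/set0Pn => w; rewrite inE => /andP[/imsetP[x _ ->] /imsetP[y _ /clE]].
rewrite add0r mul1r => e; exists (val x), (val y).
by rewrite e -addrA -mulrA subrr addr0; reflexivity.
Qed.

(** A solution modulo [pi] has value n with u / n congruent to 1; multiplying both coordinates by a
    square root of u / n multiplies the form by u / n. *)
Lemma norm_surj d u k : d \is a GRing.unit -> u \is a GRing.unit ->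
  exists x y, congr_mod (pi ^+ k) (x * x - d * y * y) u.
Proof.
move=> hd hu; have [x [y e]] := norm_residue u hd.
set n := _ - _ in e; have hn : n \is a GRing.unit := congr_unit e hu.
have hv : congr_mod pi (u / n) 1 by rewrite -e mulrV //; reflexivity.
have [s [hs _]] := sqrt_congr1 k hv; exists (s * x), (s * y).
have /(congr_mod_leq (leqnSn k)) : congr_mod (pi ^+ k.+1) (s * s * n) u.
  by rewrite hs divrK //; reflexivity.
by rewrite (_ : s * s * n = s * x * (s * x) - d * (s * y) * (s * y)) // /n; ring.
Qed.

End CompleteDvr.

(** Inverses are lifted by multiplying errors: 1 - w (y + y0 - w y y0) = (1 - w y) (1 - w y0). *)
Lemma unit_mod_exp (R : comNzRingType) (p w : R) k :
  unit_mod p w -> unit_mod (p ^+ k) w.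
Proof.
move=> [y0 [z0 e0]]; elim: k => [|k [y [z e]]].
  by exists 0, (w * 0 - 1); rewrite expr0 mul1r.
exists (y + y0 - w * y * y0), (- (z * z0)).
rewrite exprS (_ : p * _ * _ = - ((p ^+ k * z) * (p * z0))); last by ring.
by rewrite -e -e0; ring.
Qed.

(** Placing [eps] off the diagonal lets all three parameters range over [O] for both groups. When
    eps^2 = e, the determinant is -(x^2 + e y z), again in [O]. *)
Definition tr0mx (O R : comNzRingType) (iota : O -> R) (eps : R) (x y z : O) :=
  mx22 (iota x) (eps * iota y) (eps * iota z) (- iota x).

(* What the counting argument uses of the pair (G, g): elements of g of trace
   zero have the form [tr0mx], g is stable under G, and G contains a scalar
   multiple of each matrix conjugating [tr0mx 0 w 1] to [tr0mx x y z]. *)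
Record group_datum (O : idomainType) (pi : O) (R : comNzRingType)
    (iota : {rmorphism O -> R}) (eps : R) (e : O)
    (inG ing : nat -> 'M[R]_2 -> Prop) (l : nat) : Prop := GroupDatum {
  gd_eps : eps * eps = iota e;
  gd_unit : e \is a GRing.unit;
  gd_inj : forall k x y,
    congr_mod (iota pi ^+ k) (iota x) (iota y) -> congr_mod (pi ^+ k) x y;
  gd_inverse : forall g, inG l g ->
    exists gi, mcong (iota pi ^+ l) (g *m gi) 1%:M;
  gd_mul : forall g h, inG l g -> inG l h -> inG l (g *m h);
  gd_inv : forall g gi, inG l g -> mcong (iota pi ^+ l) (g *m gi) 1%:M -> inG l gi;
  gd_conj : forall k g gi A, (k <= l)%N -> inG l g ->
    mcong (iota pi ^+ l) (g *m gi) 1%:M -> ing k A -> ing k (g *m A *m gi);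
  gd_sub : forall k A B, ing k A -> ing k B -> ing k (A - B);
  gd_tr0 : forall k A, ing k A -> congr_mod (iota pi ^+ k) (\tr A) 0 ->
    exists x y z, mcong (iota pi ^+ k) A (tr0mx iota eps x y z);
  gd_K : forall x y z, inG l (1%:M + iota pi ^+ l2 l *: tr0mx iota eps x y z);
  gd_upper : forall v z, z \is a GRing.unit -> exists c : R,
    inG l (c *: mx22 1 (eps * iota v) 0 (iota z));
  gd_anti : forall v y, y \is a GRing.unit -> exists c : R,
    inG l (c *: mx22 0 (iota y) 1 (- (eps * iota v)))
}.

(** * Conjugacy of trace-zero matrices, for both groups at once *)

Section Datum.
Variables (O : idomainType) (pi : O) (R : comNzRingType)
  (iota : {rmorphism O -> R}) (eps : R) (e : O)
  (inG ing : nat -> 'M[R]_2 -> Prop) (l : nat).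
Hypothesis dvr : complete_dvr pi.
Hypothesis lge2 : (2 <= l)%N.
Hypothesis datum : group_datum pi iota eps e inG ing l.

Local Notation M := (tr0mx iota eps).
Local Notation "A === B 'at' k" := (mcong (iota pi ^+ k) A B)
  (at level 70, B at next level, k at next level).

Let l1_gt0 : (0 < l1 l)%N. Proof. by rewrite /l1; lia. Qed.
Let l1_le : (l1 l <= l)%N. Proof. by rewrite /l1; lia. Qed.
Let l12 : (l2 l + l1 l)%N = l. Proof. by rewrite /l1 /l2; lia. Qed.
Let mc1 A B : A === B at l -> A === B at l1 l := mcong_leq l1_le.
Let cgP k x y : (0 < k)%N -> congr_mod (iota pi ^+ k) x y -> congr_mod (iota pi) x y.
Proof. by move=> k0 h; rewrite -[iota pi]expr1; apply: congr_mod_leq h. Qed.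

Lemma iota_congr k x y : congr_mod (pi ^+ k) x y ->
  congr_mod (iota pi ^+ k) (iota x) (iota y).
Proof. by case=> z h; exists (iota z); rewrite -rmorphXn -rmorphM -h rmorphB. Qed.

Lemma tr0mx_congr k x y z x' y' z' : congr_mod (pi ^+ k) x x' ->
  congr_mod (pi ^+ k) y y' -> congr_mod (pi ^+ k) z z' ->
  M x y z === M x' y' z' at k.
Proof.
move=> /iota_congr hx /iota_congr hy /iota_congr hz.
by apply: mcong_mx22; rewrite ?hx ?hy ?hz; reflexivity.
Qed.

Lemma conj_det u y z u' y' z' g : inG l g ->
  g *m M u y z === M u' y' z' *m g at l1 l ->
  congr_mod (pi ^+ l1 l) (u * u + e * y * z) (u' * u' + e * y' * z').
Proof.
move=> /(gd_inverse datum)[gi /mc1 hg] h; apply: (gd_inj datum).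
have dM a b c : \det (M a b c) = - iota (a * a + e * b * c).
  rewrite det_mx22 rmorphD !rmorphM -(gd_eps datum); ring.
have hd : congr_mod (iota pi ^+ l1 l) (\det g * \det gi) 1.
  by rewrite -det_mulmx (mcong_det hg) det1; reflexivity.
have := mcong_det h; rewrite !det_mulmx !dM => h'.
move: (iota (u * u + _)) (iota (u' * u' + _)) (\det g) (\det gi) hd h' => d1 d2 D D' hd h'.
transitivity (- (D * - d1 * D')).
  by rewrite -{1}[d1]mul1r -hd; apply: eq_congr; ring.
by rewrite h' -{2}[d2]mulr1 -hd; apply: eq_congr; ring.
Qed.

(** A basis vector b is cyclic for X = [M u y z]: the second one if [y] is a unit, the first one if
    [z] is. Up to a scalar, the columns of [h] are b and eps^-1 X b, and the hypothesis on [w] says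
    X^2 = e w. *)
Lemma conj_exists u y z w : (y \is a GRing.unit) || (z \is a GRing.unit) ->
  congr_mod (pi ^+ l1 l) (e * w) (u * u + e * y * z) ->
  exists h, inG l h /\ h *m M 0 w 1 === M u y z *m h at l1 l.
Proof.
move=> hyz hw; have ue := gd_unit datum.
have [v eu] : exists v, u = e * v by exists (u / e); rewrite mulrC divrK.
have iu : iota u = eps * eps * iota v by rewrite eu rmorphM (gd_eps datum).
have iw : congr_mod (iota pi ^+ l1 l) (iota w) (iota (u * v + y * z)).
  apply/iota_congr/(congr_mod_cancel ue); rewrite hw.
  by rewrite (_ : _ + _ = e * (u * v + y * z)); [reflexivity | rewrite eu; ring].
suff [c [h [hG hM]]] : exists c h, inG l (c *: h) /\ h *m M 0 w 1 === M u y z *m h at l1 l.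
  by exists (c *: h); split=> //; rewrite -scalemxAl -scalemxAr hM; reflexivity.
case/orP: hyz => hu.
  have [c hG] := gd_anti datum v hu; exists c; eexists; split; first exact: hG.
  rewrite !mul_mx22 rmorph0 rmorph1; apply: mcong_mx22;
    by rewrite ?iw ?iu ?rmorphD ?rmorphM ?iu; apply: eq_congr; ring.
have [c hG] := gd_upper datum v hu; exists c; eexists; split; first exact: hG.
rewrite !mul_mx22 rmorph0 rmorph1; apply: mcong_mx22;
  by rewrite ?iw ?iu ?rmorphD ?rmorphM ?iu; apply: eq_congr; ring.
Qed.

(** * The stabilizer of the character is a centralizer modulo pi^l1 *)

Section Stabilizer.
Variable psi : R -> algC.
Hypothesis hpsi : add_char iota pi l psi.

Lemma psi_congr x y : congr_mod (iota pi ^+ l) x y -> psi x = psi y.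
Proof.
case: hpsi => hD [h1 _] [z h].
by rewrite -[x](subrK y) h hD h1 mul1r.
Qed.

Lemma psi_neq0 x : psi x != 0.
Proof.
case: hpsi => hD [h1 _]; apply: contra_eq_neq (h1 0) => h0.
by rewrite mulr0 -(subrr x) hD h0 mul0r eq_sym oner_eq0.
Qed.

(** Otherwise [c] divides pi^(l1-1), so [psi] would be trivial on pi^(l2+l1-1) O = pi^(l-1) O. *)
Lemma psi_faithful c :
  (forall b, psi (iota (pi ^+ l2 l * (c * b))) = 1) -> congr_mod (pi ^+ l1 l) c 0.
Proof.
move=> h; apply: NNPP => /(dvd_pi_exp_pred dvr)[b hb].
case: hpsi => _ [_ [z]]; apply/negP; rewrite negbK.
rewrite -[X in _ == X](h (b * z)) [c * _]mulrA hb [X in _ == psi (iota X)]mulrA -exprD.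
by rewrite (_ : (l2 l + (l1 l).-1)%N = l.-1) //; lia.
Qed.

(** Cyclicity of the trace moves the conjugation from [k] onto [At]. *)
Lemma psiA_conj (At s k si : 'M[R]_2) : s *m si === 1%:M at l ->
  psiA psi At (s *m k *m si) = psi (\tr (si *m At *m s *m (k - 1%:M))).
Proof.
move=> hs; rewrite /psiA; apply: psi_congr.
have -> : s *m k *m si - 1%:M === s *m (k - 1%:M) *m si at l.
  by rewrite mulmxBr mulmxBl mulmx1 hs; reflexivity.
by rewrite mulmxA mxtrace_mulC !mulmxA; reflexivity.
Qed.

(** If [s] centralizes [At] modulo pi^l1, the error meets k - 1, which is divisible by pi^l2, and
    disappears because l1 + l2 = l. Conversely the defect [C] lies in the Lie algebra with trace
    zero, so its three coordinates can be tested one at a time. *)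
Lemma inSP At s : ing l At ->
  inS iota pi inG l psi At s <-> inG l s /\ s *m At === At *m s at l1 l.
Proof.
move=> hA; split=> [[si [[hG hs] hk]]|[hG hs]]; last first.
  have [si hsi] := gd_inverse datum hG; exists si; split=> // k [_].
  have h : si *m At *m s === At at l1 l.
    by rewrite -mulmxA -hs mulmxA (mc1 (mcong_mul1C hsi)) mul1mx; reflexivity.
  move/mcongP: h => [Z h] /mcongP[B hB].
  rewrite psiA_conj // /psiA; apply: psi_congr; exists (\tr (Z *m B)).
  rewrite -linearB -mulmxBl h hB /= -scalemxAl -scalemxAr scalerA linearZ.
  by rewrite /= -exprD addnC l12.
split=> //; have hs' := mcong_mul1C hs.
pose C := si *m At *m s - At.
have gC : ing l C.
  apply: (gd_sub datum) => //.
  exact: (gd_conj datum (leqnn l) (gd_inv datum hG hs) hs' hA).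
have tC : congr_mod (iota pi ^+ l) (\tr C) 0.
  by rewrite linearB /= -mulmxA mxtrace_mulC -mulmxA hs mulmx1 subrr; reflexivity.
have [p [q [r hC]]] := gd_tr0 datum gC tC.
(* The argument is pi^l2 times the trace of [M p q r] times [M b1 b2 b3]. Setting two of the [b]'s
   to zero isolates one coordinate, with coefficient the unit 2 or [e]. *)
have hp b1 b2 b3 : psi (iota (pi ^+ l2 l * (2 * p * b1 + e * q * b3 + e * r * b2))) = 1.
  have := hk (1%:M + iota pi ^+ l2 l *: M b1 b2 b3).
  rewrite /inK => /(_ (conj (gd_K datum _ _ _) _)).
  have hK : 1%:M + iota pi ^+ l2 l *: M b1 b2 b3 === 1%:M at l2 l.
    by apply/mcongP; exists (M b1 b2 b3); rewrite addrC addKr.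
  move/(_ hK); rewrite psiA_conj // /psiA addrC addKr.
  set K := iota pi ^+ l2 l *: _.
  rewrite -[si *m At *m s](subrK At) -/C mulmxDl linearD /= (proj1 hpsi).
  rewrite -[X in _ = X]mul1r => /(mulIf (psi_neq0 _)) <-.
  apply: psi_congr; rewrite hC /K -scalemxAr linearZ /= mul_mx22 tr_mx22.
  rewrite rmorphM rmorphXn !rmorphD !rmorphM -(gd_eps datum) rmorph_nat.
  by apply: eq_congr; ring.
have ue := gd_unit datum; have u2 := unit2 dvr.
have p0 : congr_mod (pi ^+ l1 l) p 0.
  apply: (congr_mod_cancel u2); rewrite mulr0; apply: psi_faithful => b.
  by rewrite -[RHS](hp b 0 0); congr (psi (iota _)); ring.
have q0 : congr_mod (pi ^+ l1 l) q 0.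
  apply: (congr_mod_cancel ue); rewrite mulr0; apply: psi_faithful => b.
  by rewrite -[RHS](hp 0 0 b); congr (psi (iota _)); ring.
have r0 : congr_mod (pi ^+ l1 l) r 0.
  apply: (congr_mod_cancel ue); rewrite mulr0; apply: psi_faithful => b.
  by rewrite -[RHS](hp 0 b 0); congr (psi (iota _)); ring.
have C0 : C === M 0 0 0 at l1 l.
  by rewrite (mc1 hC); apply: tr0mx_congr.
have M0 : M 0 0 0 = 0.
  by rewrite /tr0mx rmorph0 mulr0 oppr0; apply/matrixP; elim/ord2_ind; elim/ord2_ind; rewrite !mxE.
have h : si *m At *m s === At at l1 l.
  by rewrite -[si *m At *m s](subrK At) -/C C0 M0 add0r; reflexivity.
transitivity (s *m (si *m At *m s)); first by rewrite h; reflexivity.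
by rewrite !mulmxA (mc1 hs) mul1mx; reflexivity.
Qed.

End Stabilizer.

(** * Double cosets in the coordinates x, y, z, and their number *)

Section Counting.
Variables (psi : R -> algC) (a beta : O) (A1t A2t : 'M[R]_2).
Hypotheses (hpsi : add_char iota pi l psi) (ua : a \is a GRing.unit)
  (gA1 : ing l A1t) (gA2 : ing l A2t) (gA2' : ing (l1 l) (M 0 (pi * beta) 1))
  (eA1 : A1t === M a 0 0 at l1 l) (eA2 : A2t === M 0 (pi * beta) 1 at l1 l).
Implicit Types (g h s : 'M[R]_2) (x y z : O).

Local Notation S1 := (inS iota pi inG l psi A1t).
Local Notation S2 := (inS iota pi inG l psi A2t).
Local Notation DC := (dcoset iota pi inG l psi A1t A2t).

(* [shape g x y z]: g A_2 g^-1 is [tr0mx x y z] modulo pi^l1. *)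
Local Notation shape g x y z := (g *m A2t === M x y z *m g at l1 l).

Let pi_congr x y : congr_mod (iota pi) (iota x) (iota y) -> congr_mod pi x y.
Proof. by rewrite -(expr1 (iota pi)) -[X in _ -> congr_mod X _ _]expr1; apply: (gd_inj datum). Qed.

Let iota_pi x y : congr_mod pi x y -> congr_mod (iota pi) (iota x) (iota y).
Proof. by rewrite -(expr1 (iota pi)) -[X in congr_mod X _ _ -> _]expr1; apply: iota_congr. Qed.

Let eps_cancel w : congr_mod (iota pi) (eps * w) 0 -> congr_mod (iota pi) w 0.
Proof.
move=> h; have ee : eps * iota e^-1 * eps = 1.
  by rewrite mulrAC (gd_eps datum) -rmorphM mulrV ?rmorph1 //; apply: gd_unit datum.
by rewrite -[w]mul1r -ee -mulrA h mulr0; reflexivity.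
Qed.

Let iota_cancel x w : x \is a GRing.unit ->
  congr_mod (iota pi) (iota x * w) 0 -> congr_mod (iota pi) w 0.
Proof.
move=> ux h; rewrite -[w]mul1r -(rmorph1 iota) -(mulVr ux) rmorphM -mulrA h mulr0.
by reflexivity.
Qed.

Let mcP A B : A === B at l1 l -> mcong (iota pi) A B.
Proof. by move=> h i j; apply: cgP l1_gt0 (h i j). Qed.

Lemma shape_inv g gi x y z : g *m gi === 1%:M at l ->
  shape g x y z -> g *m A2t *m gi === M x y z at l1 l.
Proof. by move=> /mc1 hg h; rewrite h -mulmxA hg mulmx1; reflexivity. Qed.

(** Conjugation by [g] preserves the Lie algebra and the trace, so the conjugate of A_2 still has
    coordinates. *)
Lemma shape_exists g : inG l g -> exists x y z, shape g x y z.
Proof.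
move=> hG; have [gi hg] := gd_inverse datum hG; have hg' := mcong_mul1C hg.
have hX := gd_conj datum l1_le hG hg gA2'.
have [|x [y [z h]]] := gd_tr0 datum hX.
  rewrite -mulmxA mxtrace_mulC -mulmxA (mc1 hg') mulmx1 tr_mx22 rmorph0 oppr0 addr0.
  by reflexivity.
exists x, y, z; rewrite -h -(mulmxA _ gi) (mc1 hg') mulmx1 eA2; reflexivity.
Qed.

Lemma shape_congr g x x' y z : congr_mod (pi ^+ l1 l) x x' ->
  shape g x y z -> shape g x' y z.
Proof.
move=> hx ->.
have -> : M x y z === M x' y z at l1 l by apply: tr0mx_congr => //; reflexivity.
by reflexivity.
Qed.

Lemma shape_det g x y z : inG l g -> shape g x y z ->
  congr_mod (pi ^+ l1 l) (e * (pi * beta)) (x * x + e * y * z).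
Proof.
move=> hG h.
have := @conj_det 0 (pi * beta) 1 x y z g hG; rewrite -eA2 => /(_ h).
by rewrite mulr0 add0r mulr1.
Qed.

(** A_2 has lower left entry [eps], which is invertible, so neither A_2 nor any conjugate of it
    vanishes modulo [pi]. *)
Lemma shape_neq0 g x y z : inG l g -> shape g x y z ->
  congr_mod pi x 0 -> congr_mod pi y 0 -> congr_mod pi z 0 -> False.
Proof.
move=> hG h hx hy hz; have [gi hg] := gd_inverse datum hG; have hg' := mcong_mul1C hg.
have hM : mcong (iota pi) (M x y z) 0.
  move: (iota_pi hx) (iota_pi hy) (iota_pi hz); rewrite !rmorph0 => ix iy iz.
  by elim/ord2_ind; elim/ord2_ind; rewrite !mxE /= ?ix ?iy ?iz ?mulr0 ?oppr0; reflexivity.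
have : mcong (iota pi) (M 0 (pi * beta) 1) 0.
  rewrite -(mcP eA2) -[A2t]mul1mx -(mcP (mc1 hg')) -mulmxA (mcP h) hM mul0mx mulmx0.
  by reflexivity.
move/(_ i2 i1); rewrite !mxE /= => /eps_cancel.
rewrite -(rmorph0 iota) => /pi_congr h1.
by have /(unit_congr dvr) := unitr1 O.
Qed.

Lemma shape_unit g x y z : inG l g -> shape g x y z ->
  x \is a GRing.unit <->
  unit_mod (iota pi ^+ l) (g i1 i2) /\ unit_mod (iota pi ^+ l) (g i2 i2).
Proof.
move=> hG h; have [gi hg] := gd_inverse datum hG.
have hg' := mcP (mc1 (mcong_mul1C hg)).
have pb : congr_mod (iota pi) (iota (pi * beta)) 0.
  by rewrite rmorphM; apply: congr_mod_mulr.
have hX : mcong (iota pi) (M x y z) (g *m mx22 0 0 eps 0 *m gi).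
  rewrite -(mcP (shape_inv hg h)) (mcP eA2).
  have -> : mcong (iota pi) (M 0 (pi * beta) 1) (mx22 0 0 eps 0).
    by apply: mcong_mx22; rewrite ?pb ?rmorph0 ?rmorph1 ?mulr0 ?mulr1 ?oppr0; reflexivity.
  by reflexivity.
move: hg' hX; rewrite (mx22_eta g) (mx22_eta gi) !mul_mx22 one_mx22 !mx22E.
move: (g i1 i1) (g i1 i2) (g i2 i1) (g i2 i2) => p q r s.
move: (gi i1 i1) (gi i1 i2) (gi i2 i1) (gi i2 i2) => p' q' r' s' hg' hX.
have X11 : congr_mod (iota pi) (iota x) (q * (eps * p')).
  by have := hX i1 i1; rewrite !mx22E => ->; apply: eq_congr; ring.
have X22 : congr_mod (iota pi) (- iota x) (s * (eps * q')).
  by have := hX i2 i2; rewrite !mx22E => ->; apply: eq_congr; ring.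
split=> [ux|[hq hs]].
  have xx : iota x * iota x^-1 = 1 by rewrite -rmorphM mulrV ?rmorph1.
  split; apply: unit_mod_exp.
    by exists (eps * p' * iota x^-1); rewrite mulrA -X11 xx; reflexivity.
  exists (- (eps * q' * iota x^-1)); rewrite mulrN mulrA -X22 mulNr xx opprK.
  by reflexivity.
(* If x vanished modulo [pi], the diagonal entries of X would force the first row (p', q') of the
   inverse of [g] to vanish, against its product with [g] being 1. *)
apply/(unit_congr dvr) => /iota_pi; rewrite rmorph0 => x0.
have cancel w b : unit_mod (iota pi ^+ l) w ->
    congr_mod (iota pi) (w * (eps * b)) 0 -> congr_mod (iota pi) b 0.
  have l0 : (0 < l)%N by apply: ltnW.
  case=> w' /(cgP l0) hw hb; apply: eps_cancel.
  rewrite -[eps * b]mul1r -hw mulrAC hb mul0r; reflexivity.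
have p0 : congr_mod (iota pi) p' 0 by apply: cancel hq _; rewrite -X11.
have q0 : congr_mod (iota pi) q' 0.
  by apply: cancel hs _; rewrite -X22 x0 oppr0; reflexivity.
have := hg' i1 i1; rewrite !mx22E p0 q0 !mul0r addr0 -(rmorph0 iota) -(rmorph1 iota).
move/pi_congr => h01; have /(unit_congr dvr) := unitr1 O; apply.
by symmetry.
Qed.

(** Equality of double cosets is equality of predicates on lifts; this relation between
    representatives is what can be computed with, and [dcoset_eq] and [dcrel_of_dcoset]
    translate. *)
Definition dcrel g h := exists s1 s2, [/\ S1 s1, S2 s2 & h === s1 *m g *m s2 at l].

Lemma inS_mul At s t : ing l At -> inS iota pi inG l psi At s ->
  inS iota pi inG l psi At t -> inS iota pi inG l psi At (s *m t).
Proof.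
move=> hA /(inSP hpsi _ hA)[sG hs] /(inSP hpsi _ hA)[tG ht]; apply/(inSP hpsi _ hA).
split; first exact: (gd_mul datum).
by rewrite -mulmxA ht mulmxA hs mulmxA; reflexivity.
Qed.

Lemma inS_inv At s : ing l At -> inS iota pi inG l psi At s ->
  exists si, inS iota pi inG l psi At si /\ s *m si === 1%:M at l.
Proof.
move=> hA /(inSP hpsi _ hA)[sG hs]; have [si hsi] := gd_inverse datum sG.
exists si; split=> //; apply/(inSP hpsi _ hA); split; first exact: (gd_inv datum sG hsi).
have hsi' := mcong_mul1C hsi.
transitivity (si *m (At *m s) *m si).
  by rewrite -!mulmxA (mc1 hsi) mulmx1; reflexivity.
by rewrite -hs !mulmxA (mc1 hsi') mul1mx; reflexivity.
Qed.

Lemma inG1 : inG l 1%:M.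
Proof.
have := gd_K datum 0 0 0; rewrite /tr0mx rmorph0 mulr0 oppr0 (_ : mx22 0 0 0 0 = 0).
  by rewrite scaler0 addr0.
by apply/matrixP; elim/ord2_ind; elim/ord2_ind; rewrite !mxE.
Qed.

Lemma inS1 At : ing l At -> inS iota pi inG l psi At 1%:M.
Proof.
move=> hA; apply/(inSP hpsi _ hA); split; first exact: inG1.
by rewrite mul1mx mulmx1; reflexivity.
Qed.

Lemma dcrel_sym g h : dcrel g h -> dcrel h g.
Proof.
move=> [s1 [s2 [/(inS_inv gA1)[t1 [h1 e1]] /(inS_inv gA2)[t2 [h2 e2]] eh]]].
exists t1, t2; split=> //; rewrite eh !mulmxA (mcong_mul1C e1) mul1mx -mulmxA e2 mulmx1.
by reflexivity.
Qed.

Lemma dcrel_sub g h m : dcrel g h -> DC h m -> DC g m.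
Proof.
move=> [s1 [s2 [h1 h2 eh]]] [t1 [t2 [k1 [k2 em]]]].
exists (t1 *m s1), (s2 *m t2); split; first exact: inS_mul.
split; first exact: inS_mul.
by rewrite /mc em eh !mulmxA; reflexivity.
Qed.

Lemma dcoset_eq g h : dcrel g h -> DC g = DC h.
Proof.
move=> r; apply: functional_extensionality => m; apply: propositional_extensionality.
by split; apply: dcrel_sub => //; apply: dcrel_sym.
Qed.

Lemma dcrel_of_dcoset g h : DC g = DC h -> dcrel g h.
Proof.
move=> eq; have : DC h h.
  exists 1%:M, 1%:M; split; first exact: inS1.
  split; first exact: inS1.
  by rewrite /mc mul1mx mulmx1; reflexivity.
by rewrite -eq => -[s1 [s2 [h1 [h2 k]]]]; exists s1, s2.
Qed.

(** This invariant separates the two double cosets when x is not a unit. Modulo [pi], an element of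
    S_{A_1} has lower left entry [r] = 0 since 2 a is a unit; the lower left entries of [hM] then
    give s z = z' p. If z' vanished, so would [s], and with it the whole second row of an invertible
    matrix. *)
Lemma dcrel_unit g h x y z x' y' z' : inG l g ->
  shape g x y z -> shape h x' y' z' -> dcrel g h ->
  z \is a GRing.unit -> z' \is a GRing.unit.
Proof.
move=> gG hg hh [s1 [s2 [/(inSP hpsi _ gA1)[G1 c1] /(inSP hpsi _ gA2)[G2 c2] eh]]] uz.
have [ki hk] := gd_inverse datum (gd_mul datum gG G2).
have hM : s1 *m M x y z === M x' y' z' *m s1 at l1 l.
  transitivity (s1 *m M x y z *m (g *m s2 *m ki)).
    by rewrite (mc1 hk) mulmx1; reflexivity.
  transitivity (M x' y' z' *m s1 *m (g *m s2 *m ki)); last first.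
    by rewrite (mc1 hk) mulmx1; reflexivity.
  rewrite !mulmxA -(mulmxA s1 (M x y z) g) -hg -(mulmxA _ s1 g) -(mulmxA _ (s1 *m g)) -(mc1 eh) -hh.
  by rewrite (mc1 eh) -!mulmxA (mulmxA s2) c2 !mulmxA; reflexivity.
have [s1i h1] := gd_inverse datum G1.
move: (mcP hM) (mcP (mc1 h1)); rewrite eA1 in c1; move/mcP: c1.
rewrite (mx22_eta s1) (mx22_eta s1i) !mul_mx22 one_mx22.
move: (s1 i1 i1) (s1 i1 i2) (s1 i2 i1) (s1 i2 i2) => p q r s.
move: (s1i i1 i1) (s1i i1 i2) (s1i i2 i1) (s1i i2 i2) => p' q' r' s' hc hX hI.
have r0 : congr_mod (iota pi) r 0.
  have u2a : 2 * a \is a GRing.unit by rewrite unitrM (unit2 dvr).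
  apply: (iota_cancel u2a).
  have := hc i2 i1; rewrite !mx22E rmorph0 => /congr_mod_sub <-.
  by rewrite rmorphM rmorph_nat; apply: eq_congr; ring.
apply/(unit_congr dvr) => /iota_pi; rewrite rmorph0 => z0.
have s0 : congr_mod (iota pi) s 0.
  apply: (iota_cancel uz); apply: eps_cancel.
  have := hX i2 i1; rewrite !mx22E r0 z0 !(mul0r, mulr0) !add0r => <-.
  by apply: eq_congr; ring.
have := hI i2 i2; rewrite !mx22E r0 s0 !mul0r addr0 -(rmorph0 iota) -(rmorph1 iota).
move/pi_congr => h01; have /(unit_congr dvr) := unitr1 O; apply.
by symmetry.
Qed.

(* The torus acts transitively on the pairs (y, z) with given product and
   given unit coordinate. *)
Lemma shape_dcrel g h x y z y' z' : inG l g -> inG l h ->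
  shape g x y z -> shape h x y' z' -> congr_mod (pi ^+ l1 l) (y * z) (y' * z') ->
  (y \is a GRing.unit) && (y' \is a GRing.unit) ||
  (z \is a GRing.unit) && (z' \is a GRing.unit) -> dcrel g h.
Proof.
move=> gG hG hg hh hyz units.
(* The unit pair dictates t = y / y' or t = z' / z; the other congruence follows from y z = y'
   z'. *)
have [t [ut ty tz]] : exists t, [/\ t \is a GRing.unit,
    congr_mod (pi ^+ l1 l) y (y' * t) & congr_mod (pi ^+ l1 l) (t * z) z'].
  case/orP: units => /andP[u u'].
    exists (y / y'); split; first by rewrite unitrM unitrV u.
      by rewrite mulrC divrK //; reflexivity.
    by rewrite mulrAC hyz mulrC mulKr //; reflexivity.
  exists (z' / z); split; first by rewrite unitrM unitrV u u'.
    by rewrite mulrA -hyz mulrK //; reflexivity.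
  by rewrite divrK //; reflexivity.
(* With v = 0 this is a multiple of diag(1, t): it commutes with A_1 and conjugates [M x y z] to
   [M x y' z']. *)
have [c cG] := gd_upper datum 0 ut.
set s := c *: _ in cG.
have sM : s *m M x y z === M x y' z' *m s at l1 l.
  rewrite /s -scalemxAl -scalemxAr.
  have -> : mx22 1 (eps * iota 0) 0 (iota t) *m M x y z ===
            M x y' z' *m mx22 1 (eps * iota 0) 0 (iota t) at l1 l.
    move: (iota_congr ty) (iota_congr tz); rewrite !rmorphM rmorph0 => iy iz.
    rewrite !mul_mx22; apply: mcong_mx22; rewrite ?iy -?iz; apply: eq_congr; ring.
  by reflexivity.
have s1 : S1 s.
  apply/(inSP hpsi _ gA1); split=> //; rewrite eA1 /s -scalemxAl -scalemxAr !mul_mx22.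
  by rewrite rmorph0 (_ : mx22 _ _ _ _ = mx22 (iota a) 0 0 (- (iota t * iota a)));
    [rewrite (_ : mx22 (iota a * 1 + _) _ _ _ = mx22 (iota a) 0 0 (- (iota t * iota a)));
     first reflexivity|]; congr mx22; ring.
have kG := gd_mul datum cG gG; have [ki hk] := gd_inverse datum kG.
have hk' := mcong_mul1C hk.
(* Both [s *m g] and [h] conjugate A_2 to [M x y' z'], so (s g)^-1 h centralizes A_2. *)
exists s, (ki *m h); split=> //; last first.
  by rewrite !mulmxA hk mul1mx; reflexivity.
apply/(inSP hpsi _ gA2); split; first exact: (gd_mul datum (gd_inv datum kG hk) hG).
have hkM : s *m g *m A2t === M x y' z' *m (s *m g) at l1 l.
  by rewrite -mulmxA hg !mulmxA sM; reflexivity.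
transitivity (ki *m (M x y' z' *m (s *m g)) *m ki *m h).
  by rewrite -!mulmxA hh (mulmxA s) (mulmxA (s *m g)) (mc1 hk) mul1mx; reflexivity.
by rewrite -hkM (mulmxA ki (s *m g)) (mc1 hk') mul1mx -mulmxA; reflexivity.
Qed.

Local Notation W := (Wset iota pi inG l psi A1t A2t).
Local Notation conj1 g gi h hi := (Gconj iota pi inG l (l1 l)
  (A1t + g *m A2t *m gi) (A1t + h *m A2t *m hi)).

Let tr0mxD x y z : M a 0 0 + M x y z = M (a + x) y z.
Proof. by rewrite add_mx22 !rmorph0 !mulr0 !add0r -opprD -rmorphD. Qed.

(** The determinants of the sums fix (a + x)^2 + e y z, while x^2 + e y z is always e pi beta. The
    difference is a^2 + 2 a x, which gives x because 2 a is a unit, and then y z. *)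
Lemma Gconj_shape g gi h hi x y z x' y' z' :
  inG l g -> inG l h -> g *m gi === 1%:M at l -> h *m hi === 1%:M at l ->
  shape g x y z -> shape h x' y' z' -> conj1 g gi h hi ->
  congr_mod (pi ^+ l1 l) x x' /\ congr_mod (pi ^+ l1 l) (y * z) (y' * z').
Proof.
move=> gG hG hgi hhi hg hh [c [ci [[cG hc] hX]]].
have ue := gd_unit datum.
have : c *m M (a + x) y z === M (a + x') y' z' *m c at l1 l.
  rewrite -!tr0mxD -(shape_inv hgi hg) -(shape_inv hhi hh) -eA1 -hX.
  by rewrite -(mulmxA _ ci) (mc1 (mcong_mul1C hc)) mulmx1; reflexivity.
move/(conj_det cG) => hd.
have d := shape_det gG hg; have d' := shape_det hG hh; rewrite {}d' in d.
have xx : congr_mod (pi ^+ l1 l) x x'.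
  have u2a : 2 * a \is a GRing.unit by rewrite unitrM (unit2 dvr).
  apply: (congr_mod_cancel u2a).
  transitivity ((a + x) * (a + x) + e * y * z - (x * x + e * y * z) - a * a).
    by apply: eq_congr; ring.
  by rewrite hd -d; apply: eq_congr; ring.
split=> //; apply: (congr_mod_cancel ue).
transitivity (x * x + e * y * z - x * x); first by apply: eq_congr; ring.
by rewrite -d xx; apply: eq_congr; ring.
Qed.

Lemma shape_Gconj g gi h hi x y z y' z' :
  g *m gi === 1%:M at l -> h *m hi === 1%:M at l ->
  shape g x y z -> shape h x y' z' -> congr_mod (pi ^+ l1 l) (y * z) (y' * z') ->
  (y \is a GRing.unit) || (z \is a GRing.unit) ->
  (y' \is a GRing.unit) || (z' \is a GRing.unit) -> conj1 g gi h hi.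
Proof.
move=> hgi hhi hg hh hyz u u'; have ue := gd_unit datum.
(* Here e w is minus the determinant of either sum modulo pi^l1, so both sums are conjugate to the
   common normal form [M 0 w 1]. *)
pose w := (a + x) * (a + x) / e + y * z.
have ew : e * w = (a + x) * (a + x) + e * y * z.
  by rewrite mulrDr [e * (_ / _)]mulrC divrK // mulrA.
have [|k [kG hk]] := @conj_exists (a + x) y z w u; first by rewrite ew; reflexivity.
have [|k' [k'G hk']] := @conj_exists (a + x) y' z' w u'.
  by rewrite ew -!mulrA hyz; reflexivity.
have [ki hki] := gd_inverse datum kG; have [ki' hki'] := gd_inverse datum k'G.
exists (k' *m ki), (k *m ki'); split.
  split; first exact: (gd_mul datum k'G (gd_inv datum kG hki)).
  rewrite /mc mulmxA -(mulmxA k') (mcong_mul1C hki) mulmx1 hki'; reflexivity.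
rewrite /mc (shape_inv hgi hg) (shape_inv hhi hh) eA1 !tr0mxD.
transitivity (k' *m (ki *m (M (a + x) y z *m k)) *m ki').
  by rewrite !mulmxA; reflexivity.
rewrite -hk (mulmxA ki) (mc1 (mcong_mul1C hki)) mul1mx hk' -mulmxA (mc1 hki') mulmx1.
by reflexivity.
Qed.

(** Together with [shape_W], this describes W_g by coordinates: the same x and the same product y z
    modulo pi^l1. *)
Lemma W_shape g x y z D : inG l g -> shape g x y z -> W g D ->
  exists h y' z', [/\ inG l h, shape h x y' z',
    congr_mod (pi ^+ l1 l) (y * z) (y' * z') & D = DC h].
Proof.
move=> gG hg [h [hG [[gi [hi [[_ hgi] [[_ hhi] hc]]]] ->]]].
have [x' [y' [z' hh]]] := shape_exists hG.
have [xx yz] := Gconj_shape gG hG hgi hhi hg hh hc.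
by exists h, y', z'; split=> //; apply: shape_congr hh; symmetry.
Qed.

Lemma shape_W g h x y z y' z' : inG l g -> inG l h ->
  shape g x y z -> shape h x y' z' -> congr_mod (pi ^+ l1 l) (y * z) (y' * z') ->
  (y \is a GRing.unit) || (z \is a GRing.unit) ->
  (y' \is a GRing.unit) || (z' \is a GRing.unit) -> W g (DC h).
Proof.
move=> gG hG hg hh yz u u'; exists h; split=> //; split=> //.
have [gi hgi] := gd_inverse datum gG; have [hi hhi] := gd_inverse datum hG.
by exists gi, hi; do 2![split=> //]; apply: shape_Gconj hg hh _ _ _.
Qed.

(** Modulo [pi], x^2 + e y z = e pi beta = 0 gives y z = 0, and [shape_neq0] prevents both factors
    from vanishing. *)
Lemma shape_some_unit g x y z : inG l g -> shape g x y z ->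
  x \isn't a GRing.unit -> (y \is a GRing.unit) = (z \isn't a GRing.unit).
Proof.
move=> gG hg /(nonunit_congr0 dvr) x0.
have d := congr_mod_exp l1_gt0 (shape_det gG hg).
have /(nonunit_congr0 dvr) : congr_mod pi (e * y * z) 0.
  rewrite -[e * y * z](addKr (x * x)) -d x0 mulrCA; apply/congr_mod0P.
  by exists (e * beta); rewrite mul0r oppr0 add0r.
rewrite !unitrM (gd_unit datum) /=; case: (boolP (y \is a _)) => //= /(nonunit_congr0 dvr) y0 _.
apply/esym/negbF/(unit_congr dvr) => z0.
exact: shape_neq0 gG hg x0 y0 z0.
Qed.

(** Modulo [pi], -e y z is congruent to the unit x^2. *)
Lemma shape_all_unit g x y z : inG l g -> shape g x y z ->
  x \is a GRing.unit -> (y \is a GRing.unit) && (z \is a GRing.unit).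
Proof.
move=> gG hg ux; have d := congr_mod_exp l1_gt0 (shape_det gG hg).
have : - (e * y * z) \is a GRing.unit.
  have ux2 : x * x \is a GRing.unit by rewrite unitrM ux.
  apply: (congr_unit dvr) ux2; apply/congr_mod_sub.
  rewrite (_ : _ - _ = - (x * x + e * y * z)); last by ring.
  rewrite -d mulrCA -mulrN; apply: congr_mod_mulr.
by rewrite unitrN -mulrA !unitrM => /andP[].
Qed.

Lemma card_W1 g x y z : inG l g -> shape g x y z -> x \is a GRing.unit ->
  has_card (W g) 1.
Proof.
move=> gG hg ux; have /andP[uy uz] := shape_all_unit gG hg ux.
exists (fun=> DC g); split; first by move=> i j _; rewrite !ord1.
move=> D; split=> [/(W_shape gG hg)[h [y' [z' [hG hh yz ->]]]]|[_ ->]]; last first.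
  by apply: (shape_W gG gG hg hg); rewrite ?uy //; reflexivity.
have /andP[uy' uz'] := shape_all_unit hG hh ux.
exists ord0; apply/esym/dcoset_eq.
by apply: (shape_dcrel gG hG hg hh yz); rewrite uy uy'.
Qed.

Lemma card_W2 g x y z : inG l g -> shape g x y z -> x \isn't a GRing.unit ->
  has_card (W g) 2.
Proof.
move=> gG hg ux; have uyz := shape_some_unit gG hg ux.
have u : (y \is a GRing.unit) || (z \is a GRing.unit) by rewrite uyz; case: (z \is a _).
have u' : (z \is a GRing.unit) || (y \is a GRing.unit) by rewrite orbC.
(* The second double coset: exchanging y and z preserves the determinant, so the mirror image is
   again a conjugate of A_2. *)
have [|h [hG]] := @conj_exists x z y (pi * beta) u'.
  by rewrite (shape_det gG hg); apply: eq_congr; ring.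
rewrite -eA2 => hh.
have yz : congr_mod (pi ^+ l1 l) (y * z) (z * y) by apply: eq_congr; rewrite mulrC.
(* Equal cosets would make y and z units simultaneously, whereas exactly one of them is a unit. *)
have neq : DC g <> DC h.
  move=> eq; have r := dcrel_of_dcoset eq.
  have zy := dcrel_unit gG hg hh r; have yz' := dcrel_unit hG hh hg (dcrel_sym r).
  by case: (boolP (z \is a GRing.unit)) uyz zy yz' => hz -> //= zy yz';
    [have := zy isT | have := yz' isT].
exists (fun i => if i == ord0 then DC g else DC h); split.
  by elim/ord2_ind; elim/ord2_ind => //= eq; case: neq.
move=> D; split=> [/(W_shape gG hg)[k [y' [z' [kG hk yz' ->]]]]|[i ->]]; last first.
  case: (i == ord0); last exact: (shape_W gG hG hg hh).
  by apply: (shape_W gG gG hg hg); rewrite ?u //; reflexivity.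
have uyz' := shape_some_unit kG hk ux.
(* The unit coordinate of [k] is in the same position as that of [g], or as that of its mirror image
   [h]. *)
have [uu|uu] := eqVneq (z \is a GRing.unit) (z' \is a GRing.unit).
  exists i1; apply/esym/dcoset_eq/(shape_dcrel gG kG hg hk yz').
  by rewrite uyz uyz' uu; case: (z' \is a _).
exists i2; apply/esym/dcoset_eq/(shape_dcrel hG kG hh hk).
  by rewrite mulrC.
by rewrite uyz uyz'; move: uu; case: (z \is a _); case: (z' \is a _).
Qed.

End Counting.

Lemma group_datum_claim sqc : claim iota pi eps inG ing sqc l.
Proof.
move=> psi hpsi a beta A1t A2t A1 A2 /(unit_mod_unit dvr l1_gt0) ua _ gA2' _ _.
move=> [gA1 [eA1 _]] [gA2 [eA2 _]] g gG.
have E1 : A1 = M a 0 0 by rewrite /tr0mx rmorph0 mulr0.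
have E2 : A2 = M 0 (pi * beta) 1 by rewrite /tr0mx rmorph0 rmorph1 mulr1 oppr0.
rewrite E2 in gA2' eA2; rewrite E1 in eA1.
have [x [y [z hg]]] := shape_exists gA2' eA2 gG.
rewrite -(shape_unit eA2 gG hg); split=> [ux|/negP ux].
  exact: (card_W1 hpsi ua gA1 gA2 gA2' eA1 eA2 gG hg ux).
exact: (card_W2 hpsi ua gA1 gA2 gA2' eA1 eA2 gG hg ux).
Qed.

End Datum.

(** * Verification of the datum for GL_2 *)

Lemma inGL_right (R : comNzRingType) (rho : R) k (g gi : 'M[R]_2) :
  mcong (rho ^+ k) (g *m gi) 1%:M -> inGL rho k g.
Proof. by move=> h; exists gi; split=> //; apply: mcong_mul1C. Qed.

Lemma inGL_det (R : comNzRingType) (rho c : R) k (g : 'M[R]_2) :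
  congr_mod (rho ^+ k) (\det g * c) 1 -> inGL rho k g.
Proof.
move=> h; apply: (@inGL_right _ _ _ _ (c *: \adj g)).
rewrite -scalemxAr mul_mx_adj -mul_scalar_mx -scalar_mxM -[(_ * _)%:M]scalemx1 mulrC h scale1r.
by reflexivity.
Qed.

Lemma inGL_mul (R : comNzRingType) (rho : R) k (g h : 'M[R]_2) :
  inGL rho k g -> inGL rho k h -> inGL rho k (g *m h).
Proof.
move=> [gi [hg _]] [hi [hh _]]; apply: (@inGL_right _ _ _ _ (hi *m gi)).
by rewrite mulmxA -(mulmxA g) hh mulmx1 hg; reflexivity.
Qed.

(* The error term [rho^(2 l2) N^2] vanishes at level l since 2 l2 >= l. *)
Lemma mul1B1D (R : comNzRingType) (rho : R) l (N : 'M[R]_2) :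
  mcong (rho ^+ l) ((1%:M - rho ^+ l2 l *: N) *m (1%:M + rho ^+ l2 l *: N)) 1%:M.
Proof.
apply/mcongP; exists (- (rho ^+ (l2 l + l2 l - l) *: (N *m N))).
rewrite scalerN scalerA -exprD (_ : (l + (l2 l + l2 l - l))%N = (l2 l + l2 l)%N);
  last by rewrite /l2; lia.
rewrite exprD -scalerA scalemxAr scalemxAl; move: (_ *: N) => K.
by rewrite mulmxDr mulmx1 mulmxBl mul1mx addrA subrK addrAC subrr add0r.
Qed.

Lemma GL_datum (O : idomainType) (pi : O) l :
  group_datum pi (GRing.RMorphism.clone _ _ (@idfun O) _) 1 1 (inGL pi) (@ingl O) l.
Proof.
split.
- exact: mulr1.
- exact: unitr1.
- by [].
- by move=> g [gi [h _]]; exists gi.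
- exact: inGL_mul.
- move=> g gi _ h; apply: inGL_right (mcong_mul1C h).
- by [].
- by [].
- move=> k A _; rewrite (mx22_eta A) tr_mx22 => t.
  exists (A i1 i1), (A i1 i2), (A i2 i1); apply: mcong_mx22; rewrite ?mul1r; try by reflexivity.
  by rewrite -[A i2 i2](addKr (A i1 i1)) t addr0; reflexivity.
- by move=> x y z; apply: inGL_right (mcong_mul1C (mul1B1D _ _ _)).
- move=> v z uz; exists 1; rewrite scale1r; apply: (@inGL_det _ _ z^-1).
  by rewrite det_mx22 mulr0 subr0 mul1r mulrV //; reflexivity.
- move=> v y uy; exists 1; rewrite scale1r; apply: (@inGL_det _ _ (- y^-1)).
  by rewrite det_mx22 mul0r mulr1 sub0r mulrNN mulrV //; reflexivity.
Qed.

(** * Unitary and skew matrices for an abstract anti-involution *)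

Section Star.
Variables (R : comNzRingType) (m : R) (star : 'M[R]_2 -> 'M[R]_2).
Hypotheses (starK : involutive star)
  (starM : forall A B, star (A *m B) = star B *m star A)
  (starB : forall A B, star (A - B) = star A - star B)
  (star_congr : forall A B, mcong m A B -> mcong m (star A) (star B)).
Implicit Types A B g h : 'M[R]_2.

Lemma unitary_mul g h : mcong m (star g *m g) 1%:M -> mcong m (star h *m h) 1%:M ->
  mcong m (star (g *m h) *m (g *m h)) 1%:M.
Proof.
by move=> hg hh; rewrite starM -mulmxA (mulmxA (star g)) hg mul1mx hh; reflexivity.
Qed.

Lemma unitary_inv g gi : mcong m (star g *m g) 1%:M -> mcong m (g *m gi) 1%:M ->
  mcong m gi (star g).
Proof. by move=> /mcong_mul1C h h'; apply: mcong_inv_uniq h' h. Qed.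

Lemma unitary_inv_star g gi : mcong m (star g *m g) 1%:M -> mcong m (g *m gi) 1%:M ->
  mcong m (star gi *m gi) 1%:M.
Proof.
move=> hg h; have /star_congr := unitary_inv hg h; rewrite starK => ->.
exact: h.
Qed.

(** The conjugate is g A g^* modulo [m], whose star is g A^* g^*. *)
Lemma skew_conj g gi A : mcong m gi (star g) -> mcong m (A + star A) 0 ->
  mcong m (g *m A *m gi + star (g *m A *m gi)) 0.
Proof.
move=> hgi hA; have h : mcong m (g *m A *m gi) (g *m A *m star g).
  by rewrite hgi; reflexivity.
rewrite (star_congr h) h !starM starK mulmxA -mulmxDl -mulmxDr hA mulmx0 mul0mx.
by reflexivity.
Qed.

Lemma skew_sub A B : mcong m (A + star A) 0 -> mcong m (B + star B) 0 ->
  mcong m (A - B + star (A - B)) 0.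
Proof. by move=> hA hB; rewrite starB addrACA -opprD hA hB subr0; reflexivity. Qed.

End Star.

(** * Verification of the datum for GU_2 over the quadratic extension *)

Section Unitary.
Variables (O : idomainType) (pi d : O).
Hypotheses (dvr : complete_dvr pi) (ud : d \is a GRing.unit).
Local Notation E := (qext d).
Local Notation rho := (qemb d pi).
Implicit Types (A B g : 'M[E]_2) (p q r s : E).

Fact qemb_zmod : zmod_morphism (@qemb O d).
Proof. by move=> x y; congr pair; rewrite /= subrr. Qed.
Fact qemb_monoid : monoid_morphism (@qemb O d).
Proof. by split=> // x y; congr pair; rewrite /=; ring. Qed.
HB.instance Definition _ := GRing.isZmodMorphism.Build O E (@qemb O d) qemb_zmod.
HB.instance Definition _ := GRing.isMonoidMorphism.Build O E (@qemb O d) qemb_monoid.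

Fact qconj_zmod : zmod_morphism (@qconj O d).
Proof. by move=> [x y] [x' y']; congr pair; rewrite /=; ring. Qed.
Fact qconj_monoid : monoid_morphism (@qconj O d).
Proof. by split=> [|[x y] [x' y']]; congr pair; rewrite /=; ring. Qed.
HB.instance Definition _ := GRing.isZmodMorphism.Build E E (@qconj O d) qconj_zmod.
HB.instance Definition _ := GRing.isMonoidMorphism.Build E E (@qconj O d) qconj_monoid.

Lemma qconjK : involutive (@qconj O d).
Proof. by move=> [x y]; rewrite /qconj /= opprK. Qed.

Lemma qconj_emb x : qconj (qemb d x) = qemb d x.
Proof. by rewrite /qconj /= oppr0. Qed.

Lemma qconj_theta : qconj (qtheta d) = - qtheta d.
Proof. by congr pair; rewrite /= oppr0. Qed.

Lemma qtheta2 : qtheta d * qtheta d = qemb d d.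
Proof. by congr pair; rewrite /=; ring. Qed.

Lemma qnorm (x y : O) : ((x, y) : E) * @qconj O d (x, y) = qemb d (x * x - d * y * y) :> E.
Proof. by congr pair; rewrite /=; ring. Qed.

(** Multiplication by an element of [O] acts separately on the coordinates with respect to 1 and
    theta. *)
Lemma congr_qembP (m : O) p q : congr_mod (qemb d m) p q <->
  congr_mod m p.1 q.1 /\ congr_mod m p.2 q.2.
Proof.
case: p q => [p p'] [q q'] /=; split.
  move=> [[z z'] [h h']]; split; [exists z|exists z'].
    by rewrite h; ring.
  by rewrite h'; ring.
by move=> [[z h] [z' h']]; exists (z, z'); congr pair; rewrite /= ?h ?h'; ring.
Qed.

Lemma qstar_mx22 p q r s :
  qstar (mx22 p q r s) = mx22 (qconj s) (qconj q) (qconj r) (qconj p).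
Proof.
rewrite /qstar /Wmx (_ : (map_mx _ _)^T = mx22 (qconj p) (qconj r) (qconj q) (qconj s)).
  by rewrite !mul_mx22; congr mx22; ring.
by apply/matrixP; elim/ord2_ind; elim/ord2_ind; rewrite !mxE.
Qed.

Lemma qstarK A : qstar (qstar A) = A.
Proof. by rewrite [in LHS](mx22_eta A) !qstar_mx22 !qconjK -mx22_eta. Qed.

Lemma qstarM A B : qstar (A *m B) = qstar B *m qstar A.
Proof.
rewrite (mx22_eta A) (mx22_eta B).
move: (A i1 i1) (A i1 i2) (A i2 i1) (A i2 i2) => p q r s.
move: (B i1 i1) (B i1 i2) (B i2 i1) (B i2 i2) => p' q' r' s'.
rewrite mul_mx22 !qstar_mx22 mul_mx22.
by congr mx22; rewrite rmorphD !rmorphM; ring.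
Qed.

Lemma qstarB A B : qstar (A - B) = qstar A - qstar B.
Proof. by rewrite /qstar map_mxB linearB /= mulmxBr mulmxBl. Qed.

Lemma qstar_congr k A B :
  mcong (rho ^+ k) A B -> mcong (rho ^+ k) (qstar A) (qstar B).
Proof.
have cc p q : congr_mod (rho ^+ k) p q -> congr_mod (rho ^+ k) (qconj p) (qconj q).
  move=> [z h]; exists (qconj z).
  by rewrite -rmorphB h rmorphM rmorphXn /= qconj_emb.
move=> h; rewrite (mx22_eta A) (mx22_eta B) !qstar_mx22.
by apply: mcong_mx22; apply/cc/h.
Qed.

Lemma inGU_star k g : mcong (rho ^+ k) (qstar g *m g) 1%:M -> inGU rho k g.
Proof. by move=> h; split=> //; apply: inGL_right (mcong_mul1C h). Qed.

Lemma norm_exists z k : z \is a GRing.unit ->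
  exists c : E, congr_mod (rho ^+ k) (c * qconj c * qemb d z) 1.
Proof.
move=> uz; have uz' : z^-1 \is a GRing.unit by rewrite unitrV.
have [x [y h]] := norm_surj dvr k ud uz'; exists (x, y).
have hz : congr_mod (pi ^+ k) ((x * x - d * y * y) * z) 1.
  by rewrite h mulVr //; reflexivity.
rewrite qnorm -rmorphM -(rmorph1 (@qemb O d)) -rmorphXn.
by case: hz => w hz; exists (qemb d w); rewrite -rmorphB hz rmorphM.
Qed.

(** A unitary similitude with factor [z] becomes unitary after scaling by an element of norm z^-1,
    which [norm_exists] supplies. *)
Lemma inGU_scale k z g : z \is a GRing.unit -> qstar g *m g = qemb d z *: 1%:M ->
  exists c, inGU rho k (c *: g).
Proof.
move=> uz hg; have [c hc] := norm_exists k uz; exists c; apply: inGU_star.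
have -> : qstar (c *: g) = qconj c *: qstar g.
  by rewrite (mx22_eta g) scale_mx22 !qstar_mx22 scale_mx22 !rmorphM.
rewrite -scalemxAl -scalemxAr hg !scalerA [qconj c * c]mulrC -[X in mcong _ _ X]scale1r.
by apply: mcongZ hc _ _ _; reflexivity.
Qed.

Lemma GU_datum l : group_datum pi (GRing.RMorphism.clone _ _ (@qemb O d) _)
  (qtheta d) d (inGU rho) (ingu rho) l.
Proof.
split.
- exact: qtheta2.
- exact: ud.
- move=> k x y /=; rewrite -rmorphXn => /congr_qembP[] //.
- by move=> g [[gi [h _]] _]; exists gi.
- by move=> g h [_ hg] [_ hh]; apply/inGU_star/(unitary_mul qstarM).
- move=> g gi [_ hg] h; apply: inGU_star.
  exact: (unitary_inv_star qstarK (@qstar_congr l) hg h).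
- move=> k g gi A le [_ hg] h hA; have hgi := mcong_leq le (unitary_inv hg h).
  exact: (skew_conj qstarK qstarM (@qstar_congr k) hgi hA).
- by move=> k A B hA hB; exact: (skew_sub qstarB hA hB).
(* Skewness makes twice the [O]-part of each off-diagonal entry vanish, leaving multiples of theta.
   On the diagonal it gives p' = s', while trace zero gives p' = -s'; hence both vanish since 2 is a
   unit. *)
- move=> k A; rewrite /ingu (mx22_eta A) qstar_mx22 tr_mx22.
  case: (A i1 i1) (A i1 i2) (A i2 i1) (A i2 i2) => [p p'] [q q'] [r r'] [s s'].
  rewrite /= -rmorphXn => h /congr_qembP[/= t t'].
  have cancel x : congr_mod (pi ^+ k) (x + x) 0 -> congr_mod (pi ^+ k) x 0.
    move=> hx; apply: (congr_mod_cancel (unit2 dvr)); rewrite mulr0 -hx.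
    by apply: eq_congr; ring.
  have := h i1 i1; rewrite add_mx22 !mxE /= => /congr_qembP[/= _ ps'].
  have := h i1 i2; rewrite add_mx22 !mxE /= => /congr_qembP[/= /cancel q0 _].
  have := h i2 i1; rewrite add_mx22 !mxE /= => /congr_qembP[/= /cancel r0 _].
  have p0 : congr_mod (pi ^+ k) p' 0.
    apply: cancel; transitivity (p' + s' + (p' - s')); first by apply: eq_congr; ring.
    by rewrite t' ps' addr0; reflexivity.
  exists p, q', r'; apply: mcong_mx22; apply/congr_qembP; split=> /=.
  - by reflexivity.
  - exact: p0.
  - by rewrite q0; apply: eq_congr; ring.
  - by apply: eq_congr; ring.
  - by rewrite r0; apply: eq_congr; ring.
  - by apply: eq_congr; ring.
  - by rewrite -[s](addKr p) t addr0; reflexivity.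
  - by rewrite -[s'](addKr p') t' p0 addr0; reflexivity.
(* As [N] is skew, the star of 1 + rho^l2 N is 1 - rho^l2 N, its inverse modulo rho^l. *)
- move=> x y z; apply: inGU_star; set N := tr0mx _ _ _ _ _.
  have <- : 1%:M - rho ^+ l2 l *: N = qstar (1%:M + rho ^+ l2 l *: N).
    rewrite /N /tr0mx one_mx22 !scale_mx22 add_mx22 qstar_mx22.
    rewrite !rmorphD !rmorphM !rmorphXn !rmorphN /= !qconj_emb qconj_theta rmorph0 rmorph1.
    rewrite -scaleN1r scale_mx22 add_mx22; congr mx22; ring.
  exact: mul1B1D.
(* This matrix and the next are similitudes with factors [z] and [y]: the terms in theta v cancel
   because conjugation changes the sign of theta. *)
- move=> v z uz; apply: (inGU_scale _ uz).
  rewrite qstar_mx22 mul_mx22 one_mx22 scale_mx22 rmorphM /= !qconj_emb qconj_theta.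
  by rewrite rmorph0 rmorph1; congr mx22; ring.
- move=> v y uy; apply: (inGU_scale _ uy).
  rewrite qstar_mx22 mul_mx22 one_mx22 scale_mx22 rmorphN rmorphM /= !qconj_emb qconj_theta.
  by rewrite rmorph0 rmorph1; congr mx22; ring.
Qed.

End Unitary.

Theorem theorem6p2 :
  forall (O : idomainType) (pi : O), complete_dvr pi ->
  forall l : nat, (2 <= l)%N ->
    (* G = GL_2 : R = O, eps = 1, delta square *)
    claim id pi 1 (inGL pi) (@ingl O) (sq_mod pi) l /\
    (* G = GU_2 : R = O[theta], theta^2 = d a non-square unit, eps = theta,
       delta non-square *)
    (forall d : O, d \is a GRing.unit -> ~ (exists y : O, d = y * y) ->
       claim (@qemb O d) pi (qtheta d) (inGU (qemb d pi)) (ingu (qemb d pi))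
             (fun k delta => ~ sq_mod pi k delta) l).
Proof.
move=> O pi dvr l l_ge2; split; first exact: (group_datum_claim dvr l_ge2 (GL_datum pi l)).
move=> d ud _; exact: (group_datum_claim dvr l_ge2 (GU_datum dvr ud l)).
Qed.
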